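(* There is an absolute constant $c>0$ such that the following holds. Let $r\ge1$, $\delta>0$, and let $P_1,\dots,P_n\colon\mathbb{F}_2^m\to\mathbb{F}_2$ be functions with $\operatorname{rank}_1(P_i)\le r$ for all $i$. Suppose that for every $i$ and every affine subspace $V+h$ of $\mathbb{F}_2^m$, the distribution of $P_i(Y)$ for $Y$ uniform on $V+h$ has total variation distance at least $\delta$ from $\mathrm{Ber}(1/3)$. Let $\mathcal{P}$ be the distribution of $(P_1(X),\dots,P_n(X))$ for $X$ uniform on $\mathbb{F}_2^m$. Then \[ \|\mathcal{P}-\mathrm{Ber}(1/3)^{\otimes n}\|_{\mathtt{TV}}\ \ge\ 1-2^{-\frac{c^r\delta^{2r}}{r!}\, n + r}. \]
   Context: For $P\colon\mathbb{F}_2^m\to\mathbb{F}_2$ not identically zero, $\operatorname{rank}_1(P)$ is the smallest positive integer $k$ such that $P=\Gamma(L_1,\dots,L_k)$ for some polynomials $L_1,\dots,L_k$ of degree at most $1$ and some function $\Gamma\colon\mathbb{F}_2^k\to\mathbb{F}_2$. Total variation distance: $\|\mathcal{D}_1-\mathcal{D}_2\|_{\mathtt{TV}}=\frac12\sum_x|\mathcal{D}_1(x)-\mathcal{D}_2(x)|$. *)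

(* Defs.v *)
From Stdlib Require Import Rdefinitions.
From HB Require Import structures.
From mathcomp Require Import all_boot all_order all_algebra.
From mathcomp Require Import reals Rstruct exp.
Set Implicit Arguments. Unset Strict Implicit. Unset Printing Implicit Defensive.
Import Order.TTheory GRing.Theory Num.Theory.
Local Open Scope ring_scope.

Definition deg_le1 (m : nat) (L : 'rV['F_2]_m -> 'F_2) : Prop :=
  exists (a : 'rV['F_2]_m) (b : 'F_2),
    forall x, L x = \sum_(j < m) a ord0 j * x ord0 j + b.

Definition rank1_le (m : nat) (P : 'rV['F_2]_m -> 'F_2) (r : nat) : Prop :=
  exists k : nat, (0 < k)%N /\ (k <= r)%N /\
    exists (L : 'I_k -> 'rV['F_2]_m -> 'F_2) (Gamma : 'rV['F_2]_k -> 'F_2),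
      (forall j, deg_le1 (L j)) /\
      forall x, P x = Gamma (\row_j L j x).

Definition affine_set (m : nat) (V : {vspace 'rV['F_2]_m}) (h : 'rV['F_2]_m)
  : {set 'rV['F_2]_m} := [set x | x - h \in V].

Definition unif_push (T U : finType) (A : {set T}) (f : T -> U) : U -> R :=
  fun u => (#|[set x in A | f x == u]|%:R / #|A|%:R)%R.

Definition ber (p : R) : 'F_2 -> R := fun b => if b == 1 then p else (1 - p)%R.
Definition ber_prod (n : nat) (p : R) : 'rV['F_2]_n -> R :=
  fun z => (\prod_(i < n) ber p (z ord0 i))%R.

Definition tv (T : finType) (D1 D2 : T -> R) : R :=
  (1 / 2 * \sum_(x : T) `|D1 x - D2 x|)%R.

(* Main.v *)
(* Each [P i] is invariant under a subspace [U i] of codimension at most [r], and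
   the claim is proved for [X] uniform on any coset of any subspace [V], by
   induction on the codimension of the [U i] inside [V]. Choose greedily indices
   [S] whose subspaces [U i] are independent in [V], so that the outputs
   [P i X], [i] in [S], are independent. If [S] is large, a product test on the
   coordinates in [S] separates the output from the product distribution. If the
   greedy choice stops early, let [W] be the intersection of [V] and the [U i],
   [i] in [S]; every [U i] has smaller codimension inside [W] than inside [V],
   and the coset splits into at most [2 ^ (r * #|S|)] cosets of [W], so a union
   bound over these cosets reduces to the induction hypothesis. *)
Require Import Defs.
From Stdlib Require Import Rdefinitions.
From HB Require Import structures.
From mathcomp Require Import all_boot all_order all_algebra.
From mathcomp Require Import reals Rstruct exp.
From mathcomp Require Import finfield ring lra zify sequences.
Import Order.TTheory GRing.Theory Num.Theory.
Local Open Scope ring_scope.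

(** * Real inequalities behind a one-bit likelihood test *)

Section Numeric.
Context {K : realFieldType}.
Implicit Types (s F G : K).

(* A surrogate for the square root of the likelihood ratio of Ber(1/3) to
   Ber(1/3 + s), chosen so that neither it nor its inverse vanishes when 1/3 + s is
   0 or 1. The linear part has mean 1 under Ber(1/3); the factor
   [1 + s ^+ 2 * (4 / 5)] balances the two means bounded in [test_shifted] and
   [test_reference]. *)
Definition test (s : K) (b : 'F_2) : K :=
  (1 + s ^+ 2 * (4 / 5)) * (if b == 1 then 1 - s * (2 / 3) else 1 + s / 3).

Lemma test1 s : test s 1 = (1 + s ^+ 2 * (4 / 5)) * (1 - s * (2 / 3)).
Proof. by []. Qed.

Lemma test0 s : test s 0 = (1 + s ^+ 2 * (4 / 5)) * (1 + s / 3).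
Proof. by []. Qed.

Lemma test_gt0 s b : - (1 / 3) <= s <= 2 / 3 -> 0 < test s b.
Proof.
move=> /andP[s1 s2]; apply: mulr_gt0.
  by apply: ltr_pwDl => //; apply: mulr_ge0; [exact: sqr_ge0 | lra].
by case: ifP => _; lra.
Qed.

Lemma test_shifted s :
  - (1 / 3) <= s <= 2 / 3 ->
  (1 / 3 + s) * test s 1 + (1 - (1 / 3 + s)) * test s 0 <= 1 - s ^+ 2 / 8.
Proof.
move=> /andP[s1 s2]; rewrite test1 test0.
have s20 : 0 <= s ^+ 2 := sqr_ge0 s.
have s40 : 0 <= s ^+ 2 * s ^+ 2 by apply: mulr_ge0.
have -> : (1 / 3 + s) * ((1 + s ^+ 2 * (4 / 5)) * (1 - s * (2 / 3))) +
  (1 - (1 / 3 + s)) * ((1 + s ^+ 2 * (4 / 5)) * (1 + s / 3)) =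
  1 - s ^+ 2 / 5 - s ^+ 2 * s ^+ 2 * (4 / 5) by field.
lra.
Qed.

Lemma test_reference s :
  - (1 / 3) <= s <= 2 / 3 ->
  1 / 3 * (test s 1)^-1 + (1 - 1 / 3) * (test s 0)^-1 <= 1 - s ^+ 2 / 8.
Proof.
move=> hs; have t1 := test_gt0 s 1 hs; have t0 := test_gt0 s 0 hs.
move: hs t1 t0 => /andP[s1 s2]; rewrite test1 test0.
set k := 1 + _; set u := 1 - s * (2 / 3); set v := 1 + s / 3 => t1 t0.
have s20 : 0 <= s ^+ 2 := sqr_ge0 s.
have k0 : 0 < k by rewrite /k; lra.
have u0 : 0 < u by rewrite /u; lra.
have v0 : 0 < v by rewrite /v; lra.
have -> : 1 / 3 * (k * u)^-1 + (1 - 1 / 3) * (k * v)^-1 =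
          (1 - s / 3) / (k * (u * v)).
  rewrite /u /v in t1 t0 u0 v0 *; field; lra.
rewrite ler_pdivrMr; last by rewrite !mulr_gt0.
(* Here [1 - s / 3] exceeds [u * v] by [s ^+ 2 * (2 / 9)]; since [u * v] is at least [4 / 9], the
   factor [1 + s ^+ 2 * (1 / 2)] makes up for exactly that. *)
have w49 : 4 / 9 <= u * v by rewrite /u /v; nra.
have s249 : s ^+ 2 <= 4 / 9 by nra.
have kk : 1 + s ^+ 2 * (1 / 2) <= (1 - s ^+ 2 / 8) * k by rewrite /k; nra.
rewrite mulrA; apply: (le_trans _ (ler_wpM2r _ kk)); last by rewrite mulr_ge0 ?ltW.
have : s ^+ 2 * (4 / 9) <= s ^+ 2 * (u * v) by apply: ler_wpM2l.
have : u * v = 1 - s / 3 - s ^+ 2 * (2 / 9) by rewrite /u /v; field.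
move: (u * v) => w -> ; lra.
Qed.

(** One of [F] and [G] is at least 1, so one of the two terms already dominates [a] or [b]. *)
Lemma min_le_tests (a b : K) F G :
  0 <= a -> 0 <= b -> 0 <= F -> 0 <= G -> 1 <= F * G ->
  Num.min a b <= a * F + b * G.
Proof.
move=> a0 b0 F0 G0 FG; have [F1|F1] := lerP 1 F.
  by rewrite ge_min; apply/orP; left; nra.
rewrite ge_min; apply/orP; right.
have : 1 <= G by nra.
nra.
Qed.

End Numeric.

(** * Exponential bounds on products *)

Lemma subr1_le_powR2 (x : R) : 0 <= x -> 1 - x <= powR 2 (- x).
Proof.
move=> x0; rewrite /powR pnatr_eq0 /=.
apply: le_trans (expR_ge1Dx (- x * ln 2)); rewrite lerD2l mulNr lerN2.
rewrite -[leRHS]mulr1 ler_wpM2l //.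
have := @le_ln1Dx R 1; rewrite (_ : 1 + 1 = 2) //; apply; lra.
Qed.

Lemma prod_le_powR2 (I : finType) (S : {set I}) (f : I -> R) (x : R) :
  0 <= x -> (forall i, i \in S -> 0 <= f i <= 1 - x) ->
  \prod_(i in S) f i <= powR 2 (- (x * #|S|%:R)).
Proof.
move=> x0 hf; rewrite -mulNr powRrM powR_mulrn ?powR_ge0 // -prodr_const.
apply: ler_prod => i /hf /andP[-> h] /=.
exact: le_trans h (subr1_le_powR2 _ x0).
Qed.

(** * Means over cosets and independence of invariant functions *)

Section Cosets.
Context {m : nat}.
Notation E := ('rV['F_2]_m).
Implicit Types (U V W : {vspace E}) (h x : E) (F G : E -> R).

Definition invariant {T : Type} (U : {vspace E}) (F : E -> T) :=
  forall x u, u \in U -> F (x + u) = F x.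

Lemma invariantS {T : Type} U W (F : E -> T) :
  (W <= U)%VS -> invariant U F -> invariant W F.
Proof. by move=> /subvP WU hF x u /WU; apply: hF. Qed.

Definition mean (A : {set E}) (F : E -> R) : R := (\sum_(x in A) F x) / #|A|%:R.

Lemma sum_affine_set V h F :
  \sum_(x in affine_set V h) F x = \sum_(v in V) F (h + v).
Proof.
rewrite (reindex_inj (addrI h)) /=; apply: eq_bigl => v.
by rewrite inE addrC addKr.
Qed.

Lemma card_affine_set V h : #|affine_set V h| = (2 ^ \dim V)%N.
Proof.
have -> : (2 ^ \dim V)%N = #|V| by rewrite card_vspace card_Fp.
rewrite -[RHS](card_imset _ (addrI h)).
apply: eq_card => x; rewrite inE; apply/idP/imsetP => [hx|[v vV ->]].
  by exists (x - h) => //; rewrite addrC subrK.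
by rewrite addrC addKr.
Qed.

Lemma card_affine_set_gt0 V h : 0 < #|affine_set V h|%:R :> R.
Proof. by rewrite card_affine_set ltr0n expn_gt0. Qed.

Lemma sum_affine_set_shift V h v F : v \in V ->
  \sum_(x in affine_set V h) F (x + v) = \sum_(x in affine_set V h) F x.
Proof.
move=> vV; rewrite !sum_affine_set [RHS](reindex_inj (addIr v)) /=.
by apply: eq_big => x; [rewrite rpredDr | rewrite addrA].
Qed.

(* Translating [G] by [v = w + u] does not change the sum of [F x * G (x + v)]:
   [u] is absorbed by [G], and [w] by [F] after a change of variables.
   Averaging over [v] in [V] decouples [F] from [G]. *)
Lemma mean_mul V W U h F G :
  (W <= V)%VS -> (V <= W + U)%VS -> invariant W F -> invariant U G ->
  mean (affine_set V h) (fun x => F x * G x)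
    = mean (affine_set V h) F * mean (affine_set V h) G.
Proof.
move=> WV VWU hF hG; set A := affine_set V h.
have cA : #|A|%:R != 0 :> R by rewrite gt_eqF ?card_affine_set_gt0.
have shift v : v \in V -> \sum_(x in A) F x * G (x + v) = \sum_(x in A) F x * G x.
  move=> /(subvP VWU) /memv_addP[w wW [u uU ->]].
  rewrite -[RHS](sum_affine_set_shift _ _ w); last exact: (subvP WV).
  by apply: eq_bigr => x _; rewrite addrA hG // hF.
have sumG x : x \in A -> \sum_(v in V) G (x + v) = \sum_(y in A) G y.
  rewrite inE => hx; rewrite sum_affine_set (reindex_inj (addIr (h - x))) /=.
  apply: eq_big => [v|v _]; last by rewrite addrCA subrKC addrC.
  by rewrite rpredDr // -opprB memvN.
have : \sum_(v in V) \sum_(x in A) F x * G (x + v)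
       = (\sum_(x in A) F x) * (\sum_(x in A) G x).
  rewrite exchange_big /= mulr_suml; apply: eq_bigr => x xA.
  by rewrite -mulr_sumr sumG.
rewrite (eq_bigr _ shift) sumr_const card_vspace card_Fp //.
rewrite -(card_affine_set V h) -/A -mulr_natr => e.
by rewrite /mean mulrACA -e mulrA mulfK.
Qed.

(** Greedy choice by induction on the target size [t]. An index joins [S] when [W] and [U i :&: V]
    together span [V]: the product over [S] is [W]-invariant, so [mean_mul] splits off the new
    factor. *)
Lemma mean_prod_independent (n r t : nat) V h (U : 'I_n -> {vspace E}) :
  (forall i, (\dim V <= \dim (U i :&: V) + r)%N) ->
  exists (S : {set 'I_n}) (W : {vspace E}),
    [/\ (W <= V)%VS, (\dim V <= \dim W + r * #|S|)%N,
        forall i, i \in S -> (W <= U i)%VS,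
        forall F : 'I_n -> E -> R, (forall i, invariant (U i) (F i)) ->
          mean (affine_set V h) (fun x => \prod_(i in S) F i x)
            = \prod_(i in S) mean (affine_set V h) (F i)
      & #|S| = t \/ forall i, i \notin S -> ~~ (V <= W + (U i :&: V))%VS].
Proof.
move=> hU; elim: t => [|t [S [W [WV dW WS mS [cS|maxS]]]]]; last 2 first.
- have [i /andP[iS hi]|none] :=
    pickP (fun i => (i \notin S) && (V <= W + (U i :&: V))%VS); last first.
    exists S, W; split=> //; right => i iS.
    by have := none i; rewrite iS /= => ->.
  exists (i |: S), (W :&: U i)%VS; split.
  + exact: subv_trans (capvSl _ _) WV.
  (* The dimension formula for [W] and [U i :&: V] inside [V] shows that cutting [W] down by [U i]
     costs at most [r] dimensions. *)
  + have := dimv_sum_cap W (U i :&: V).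
    rewrite [in X in (_ + X)%N = _]capvC -capvA [in X in (_ + X)%N = _](capv_idPr WV).
    rewrite [in X in (_ + X)%N = _]capvC.
    have : (\dim (W + (U i :&: V)) <= \dim V)%N.
      by apply: dimvS; rewrite subv_add WV capvSr.
    move: dW (hU i); rewrite cardsU1 iS.
    move: (\dim _) (\dim _) (\dim _) (\dim _) (\dim _) (#|S|) => a b c d e f.
    nia.
  + move=> j /setU1P[->|/WS jS]; first exact: capvSr.
    exact: subv_trans (capvSl _ _) jS.
  + move=> F hF; rewrite [RHS]big_setU1 //= -mS // mulrC.
    rewrite -(@mean_mul V W (U i :&: V)) //; first 1 last.
    * move=> x u uW; apply: eq_bigr => j jS; apply: hF.
      exact: (subvP (WS j jS)).
    * exact: invariantS (capvSl _ _) (hF i).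
    by congr (_ / _); apply: eq_bigr => x _; rewrite big_setU1 //= mulrC.
  + by left; rewrite cardsU1 iS cS.
- by exists S, W; split => //; right.
exists set0, V; split=> //; first by rewrite cards0 muln0 addn0.
- by move=> i; rewrite inE.
- move=> F _; rewrite [RHS]big_set0 /mean.
  under eq_bigr do rewrite big_set0.
  rewrite sumr_const; apply: divff.
  by rewrite gt_eqF ?card_affine_set_gt0.
- by left; rewrite cards0.
Qed.

End Cosets.

(** [U] is the common kernel of the linear parts of the [L j]; rank-nullity bounds its codimension
    by their number. *)
Lemma invariant_of_rank1_le (m r : nat) (P : 'rV['F_2]_m -> 'F_2) :
  rank1_le P r ->
  exists U : {vspace 'rV['F_2]_m}, (m <= \dim U + r)%N /\ invariant U P.
Proof.
move=> [k [_ [kr [L [Gamma [hL hP]]]]]].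
have [a ha] := fin_all_exists hL; have {ha} [b ha] := fin_all_exists ha.
pose M : 'M['F_2]_(m, k) := \matrix_(j, i) a i ord0 j.
pose f := linfun (mulmxr M) : 'Hom('rV['F_2]_m, 'rV['F_2]_k).
exists (lker f); split.
  have := limg_ker_dim f fullv; rewrite capfv dimvf.
  have := dimvS (subvf (limg f)); rewrite dimvf !dim_matrix !mul1r.
  by move=> hk {1}<-; rewrite leq_add2l (leq_trans hk).
move=> x u; rewrite memv_ker lfunE /= => /eqP uM.
rewrite !hP; congr Gamma; apply/rowP => i; rewrite !mxE !ha; congr (_ + _).
under eq_bigr do rewrite mxE mulrDr.
rewrite big_split /= [X in _ + X](_ : _ = 0) ?addr0 //.
have /rowP /(_ i) := uM; rewrite !mxE => e; rewrite -[RHS]e.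
by apply: eq_bigr => j _; rewrite mxE mulrC.
Qed.

Lemma sumF2 (F : 'F_2 -> R) : \sum_b F b = F 0 + F 1.
Proof.
rewrite big_ord_recl big_ord1; congr (F _ + F _); exact: val_inj.
Qed.

Lemma sum_prod_row (n : nat) (H : 'I_n -> 'F_2 -> R) :
  \sum_(z : 'rV['F_2]_n) \prod_i H i (z ord0 i) = \prod_i \sum_b H i b.
Proof.
rewrite bigA_distr_bigA /=.
rewrite (reindex (fun f : {ffun 'I_n -> 'F_2} => \row_i f i)) /=.
  by apply: eq_bigr => f _; apply: eq_bigr => i _; rewrite mxE.
exists (fun z => [ffun i => z ord0 i]) => [f _|z _].
  by apply/ffunP => i; rewrite ffunE mxE.
by apply/rowP => i; rewrite mxE ffunE.
Qed.

(** * The common mass of two distributions, complementary to total variation *)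

Section Overlap.
Context {T : finType}.
Implicit Types D : T -> R.

Definition overlap D1 D2 : R := \sum_x Num.min (D1 x) (D2 x).

Lemma tv_overlap D1 D2 :
  \sum_x D1 x = 1 -> \sum_x D2 x = 1 -> tv D1 D2 = 1 - overlap D1 D2.
Proof.
move=> s1 s2; rewrite /tv /overlap.
have -> : \sum_x `|D1 x - D2 x| = \sum_x (D1 x + D2 x - 2 * Num.min (D1 x) (D2 x)).
  apply: eq_bigr => x _; by have [_|_] := lerP (D1 x) (D2 x); ring.
by rewrite sumrB big_split /= s1 s2 -mulr_sumr; field.
Qed.

Lemma overlap_le_tests D1 D2 (F G : T -> R) :
  (forall x, 0 <= D1 x) -> (forall x, 0 <= D2 x) ->
  (forall x, 0 <= F x) -> (forall x, 0 <= G x) -> (forall x, 1 <= F x * G x) ->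
  overlap D1 D2 <= \sum_x D1 x * F x + \sum_x D2 x * G x.
Proof.
move=> d1 d2 f0 g0 fg; rewrite -big_split; apply: ler_sum => x _.
exact: min_le_tests.
Qed.

(** Pointwise: either one [D1 i x] reaches [D2 x], and its term alone suffices, or every minimum is
    [D1 i x] and the terms sum to at least [D x]. *)
Lemma overlap_subadditive (I : finType) (Q : pred I) D D2 (D1 : I -> T -> R) :
  (forall x, 0 <= D2 x) -> (forall i x, 0 <= D1 i x) ->
  (forall x, D x <= \sum_(i | Q i) D1 i x) ->
  overlap D D2 <= \sum_(i | Q i) overlap (D1 i) D2.
Proof.
move=> d2 d1 dD; rewrite exchange_big /=; apply: ler_sum => x _.
have [/existsP[i /andP[Qi hi]]|/existsPn none] :=
  boolP [exists i, Q i && (D2 x <= D1 i x)].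
  rewrite (bigD1 i) //= (min_idPr hi) ge_min lerDl; apply/orP; right.
  by apply: sumr_ge0 => j _; rewrite le_min d1 d2.
rewrite ge_min; apply/orP; left; apply: le_trans (dD x) _.
apply: ler_sum => i Qi; have := none i; rewrite Qi /= -ltNge => /ltW h.
by rewrite (min_idPl h).
Qed.

End Overlap.

(** * Push-forwards of uniform distributions and Bernoulli products *)

Lemma unif_push_ge0 (T U : finType) (A : {set T}) (f : T -> U) u :
  0 <= unif_push A f u.
Proof. by rewrite /unif_push divr_ge0. Qed.

Lemma sum_unif_push (m : nat) (U : finType) (A : {set 'rV['F_2]_m})
    (f : 'rV['F_2]_m -> U) (F : U -> R) :
  \sum_u unif_push A f u * F u = mean A (F \o f).
Proof.
rewrite /mean [X in _ = X / _](partition_big f predT) //= mulr_suml.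
apply: eq_bigr => u _; rewrite /unif_push mulrAC; congr (_ / _).
under eq_bigr => x /andP[_ /eqP /= ->] do over.
rewrite sumr_const mulr_natl; congr (_ *+ _).
by apply: eq_card => x; rewrite inE.
Qed.

(* The argument of [ber] is parsed in Stdlib's [R_scope], so [1 / 3] below is
   Stdlib's quotient of two [IZR] literals. *)
Lemma ber1 : ber (1 / 3) 1 = 1 / 3 :> R.
Proof. by rewrite /ber eqxx RdivE !IZRposE !INRE. Qed.

Lemma ber0 : ber (1 / 3) 0 = 1 - 1 / 3 :> R.
Proof. by rewrite -ber1 /ber eqxx. Qed.

Lemma ber_cases b : ber (1 / 3) b = 1 / 3 \/ ber (1 / 3) b = 1 - 1 / 3.
Proof.
have [->|b1] := eqVneq b 1; first by left; rewrite ber1.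
by right; rewrite -ber0 /ber (negPf b1).
Qed.

Lemma ber_bounds b : 0 <= ber (1 / 3) b <= 1 - 1 / 3.
Proof. by case: (ber_cases b) => ->; lra. Qed.

Lemma ber_prod_ge0 (n : nat) (z : 'rV['F_2]_n) : 0 <= ber_prod (1 / 3) z.
Proof. by apply: prodr_ge0 => i _; have /andP[] := ber_bounds (z ord0 i). Qed.

Lemma sum_ber_prod (n : nat) (S : {set 'I_n}) (g : 'I_n -> 'F_2 -> R) :
  \sum_z ber_prod (1 / 3) z * \prod_(i in S) g i (z ord0 i)
    = \prod_(i in S) \sum_b ber (1 / 3) b * g i b.
Proof.
pose H i b := ber (1 / 3) b * (if i \in S then g i b else 1).
transitivity (\sum_(z : 'rV['F_2]_n) \prod_i H i (z ord0 i)).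
  by apply: eq_bigr => z _; rewrite big_split /= -big_mkcond.
rewrite sum_prod_row [RHS]big_mkcond; apply: eq_bigr => i _; rewrite /H.
by case: ifP => // _; rewrite sumF2 ber1 ber0; lra.
Qed.

Lemma sum_ber_prod1 (n : nat) : \sum_(z : 'rV['F_2]_n) ber_prod (1 / 3) z = 1.
Proof.
rewrite -[RHS](big_set0 1 *%R (fun i : 'I_n => \sum_b ber (1 / 3) b * 0)).
by rewrite -(sum_ber_prod n set0); apply: eq_bigr => z _; rewrite big_set0 mulr1.
Qed.

Lemma sum_unif_push1 (m : nat) (U : finType) (V : {vspace 'rV['F_2]_m}) h
    (f : 'rV['F_2]_m -> U) :
  \sum_u unif_push (affine_set V h) f u = 1.
Proof.
under eq_bigr do rewrite -[unif_push _ _ _]mulr1.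
rewrite (sum_unif_push _ _ _ _ (fun=> 1)) /mean sumr_const; apply: divff.
by rewrite gt_eqF ?card_affine_set_gt0.
Qed.

Lemma tv_ber (D : 'F_2 -> R) :
  D 0 + D 1 = 1 -> tv D (ber (1 / 3)) = `|D 1 - 1 / 3|.
Proof.
move=> hD; rewrite /tv sumF2 ber1 ber0.
have -> : D 0 - (1 - 1 / 3) = - (D 1 - 1 / 3) by lra.
by rewrite normrN; field.
Qed.

(** * Overlap bounds and the induction on codimension *)

Section RankInduction.
Context {n m : nat} (P : 'I_n -> 'rV['F_2]_m -> 'F_2).
Context (U : 'I_n -> {vspace 'rV['F_2]_m}) (delta : R).
Hypothesis P_inv : forall i, invariant (U i) (P i).
Hypothesis delta01 : 0 <= delta <= 1.
Hypothesis delta_le : forall i V h,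
  delta <= tv (unif_push (affine_set V h) (P i)) (ber (1 / 3)).

Let output x : 'rV['F_2]_n := \row_i P i x.

(** The tests are the product of [test (s i)] over [S] and its inverse, where [s i] is the bias of
    [P i] on the coset. Each mean factors over [S], with every factor at most [1 - delta ^+ 2 / 8];
    the leading 2 counts the two means. *)
Lemma overlap_independent V h (S : {set 'I_n}) :
  (forall F : 'I_n -> 'rV['F_2]_m -> R, (forall i, invariant (U i) (F i)) ->
     mean (affine_set V h) (fun x => \prod_(i in S) F i x)
       = \prod_(i in S) mean (affine_set V h) (F i)) ->
  overlap (unif_push (affine_set V h) output) (ber_prod (1 / 3))
    <= 2 * powR 2 (- (delta ^+ 2 / 8 * #|S|%:R)).
Proof.
move=> indep; set A := affine_set V h.
pose s i := unif_push A (P i) 1 - 1 / 3.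
have push01 i : unif_push A (P i) 0 + unif_push A (P i) 1 = 1.
  by rewrite -sumF2 sum_unif_push1.
have s_bounds i : - (1 / 3) <= s i <= 2 / 3.
  have := unif_push_ge0 _ _ A (P i) 0; have := unif_push_ge0 _ _ A (P i) 1.
  by move: (push01 i); rewrite /s; lra.
have s_delta i : 1 - s i ^+ 2 / 8 <= 1 - delta ^+ 2 / 8.
  have : delta ^+ 2 <= s i ^+ 2; last lra.
  rewrite -(real_normK (num_real (s i))) lerXn2r ?nnegrE //.
    by case/andP: delta01.
  by rewrite -tv_ber ?delta_le.
have t0 i b : 0 < test (s i) b := test_gt0 _ b (s_bounds i).
pose F (z : 'rV['F_2]_n) := \prod_(i in S) test (s i) (z ord0 i).
pose G (z : 'rV['F_2]_n) := \prod_(i in S) (test (s i) (z ord0 i))^-1.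
have bound (f : 'I_n -> R) : (forall i, 0 <= f i <= 1 - s i ^+ 2 / 8) ->
    \prod_(i in S) f i <= powR 2 (- (delta ^+ 2 / 8 * #|S|%:R)).
  move=> hf; apply: prod_le_powR2; first by rewrite divr_ge0 ?sqr_ge0.
  by move=> i _; case/andP: (hf i) => -> /= h1; apply: le_trans h1 (s_delta i).
have F0 z : 0 <= F z by apply: prodr_ge0 => i _; apply: ltW.
have G0 z : 0 <= G z by apply: prodr_ge0 => i _; rewrite invr_ge0 ltW.
have FG z : 1 <= F z * G z.
  rewrite -big_split /= big1 // => i _; rewrite divff //.
  by rewrite gt_eqF.
apply: le_trans (overlap_le_tests _ _ F G _ _ F0 G0 FG) _.
- exact: unif_push_ge0.
- exact: ber_prod_ge0.
rewrite mulr_natl mulr2n; apply: lerD.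
  rewrite sum_unif_push.
  have -> : mean A (F \o output) =
      mean A (fun x => \prod_(i in S) test (s i) (P i x)).
    rewrite /mean; congr (_ / _); apply: eq_bigr => x _.
    by apply: eq_bigr => i _; rewrite mxE.
  rewrite (indep (fun i x => test (s i) (P i x))); last first.
    by move=> i x u uU; rewrite P_inv.
  apply: bound => i.
  rewrite -[mean _ _](sum_unif_push _ _ A (P i) (test (s i))) sumF2 addrC.
  have -> : unif_push A (P i) 0 = 1 - (1 / 3 + s i).
    by move: (push01 i); rewrite /s; lra.
  have -> : unif_push A (P i) 1 = 1 / 3 + s i by rewrite /s; lra.
  rewrite (test_shifted _ (s_bounds i)) andbT.
  have /andP[? ?] := s_bounds i.
  by apply: addr_ge0; apply: mulr_ge0; rewrite ?(ltW (t0 i _)) //; lra.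
rewrite (sum_ber_prod n S (fun i b => (test (s i) b)^-1)); apply: bound => i.
rewrite sumF2 addrC ber1 ber0 (test_reference _ (s_bounds i)) andbT.
by apply: addr_ge0; apply: mulr_ge0; rewrite ?invr_ge0 ?(ltW (t0 i _)) //; lra.
Qed.

(** The output is a point mass, and an atom of the product law weighs at most [(2 / 3) ^+ n]. *)
Lemma overlap_constant V h :
  (forall i, (V <= U i)%VS) ->
  overlap (unif_push (affine_set V h) output) (ber_prod (1 / 3))
    <= powR 2 (- (1 / 3 * n%:R)).
Proof.
move=> VU.
have outV x : x \in affine_set V h -> output x = output h.
  rewrite inE => hx; apply/rowP => i; rewrite !mxE.
  by rewrite -[x](subrKC h) P_inv // (subvP (VU i)).
rewrite /overlap (bigD1 (output h)) //= big1 ?addr0 => [|z zh].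
  rewrite ge_min; apply/orP; right.
  have : \prod_(i in [set: 'I_n]) ber (1 / 3) (output h ord0 i)
      <= powR 2 (- (1 / 3 * #|[set: 'I_n]|%:R)).
    by apply: prod_le_powR2 => [|i _]; [lra | exact: ber_bounds].
  by rewrite cardsT card_ord /ber_prod; under eq_bigl do rewrite inE.
rewrite /unif_push (_ : [set x in _ | _] = set0).
  by rewrite cards0 mul0r; exact/min_idPl/ber_prod_ge0.
apply/setP => x; rewrite !inE; apply/negP => /andP[xA /eqP xz].
by move: zh; rewrite -xz outV ?eqxx // inE.
Qed.

(** The coset is covered by translates of [W] indexed by a complement [C] of [W] in [V]. Each piece
    enters with weight 1 instead of its share of the mixture, so the loss is the number of
    pieces. *)
Lemma overlap_split V W h K :
  (W <= V)%VS ->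
  (forall h', overlap (unif_push (affine_set W h') output) (ber_prod (1 / 3)) <= K) ->
  overlap (unif_push (affine_set V h) output) (ber_prod (1 / 3))
    <= 2 ^+ (\dim V - \dim W) * K.
Proof.
move=> WV hK; pose C := (V :\: W)%VS.
have VCW : (V <= C + W)%VS by rewrite addv_diff; exact: addvSl.
apply: le_trans (overlap_subadditive _ (mem C) _ _
  (fun u => unif_push (affine_set W (h + u)) output) _ _ _) _.
- exact: ber_prod_ge0.
- by move=> u z; apply: unif_push_ge0.
- move=> z; rewrite /unif_push.
  under [leRHS]eq_bigr do rewrite card_affine_set.
  rewrite card_affine_set -mulr_suml.
  apply: ler_pM => //.
  + by rewrite invr_ge0.
  + rewrite -natr_sum ler_nat.
    pose B u := [set x in affine_set W (h + u) | output x == z].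
    apply: (@leq_trans #|\bigcup_(u in C) B u|); last first.
      elim/big_rec2 : _ => [|u k X _ IH]; first by rewrite cards0.
      rewrite cardsU; apply: leq_trans (leq_subr _ _) _.
      by rewrite leq_add2l.
    apply: subset_leq_card; apply/subsetP => x; rewrite !inE => /andP[xV xz].
    have /memv_addP[u uC [w wW e]] := subvP VCW _ xV.
    by apply/bigcupP; exists u => //; rewrite !inE xz opprD addrA e addrC addKr wW.
  + rewrite lef_pV2 ?posrE ?ltr0n ?expn_gt0 // ler_nat leq_exp2l //.
    exact: dimvS.
apply: (@le_trans _ _ (\sum_(u in C) K)); first by apply: ler_sum => u _.
rewrite sumr_const card_vspace card_Fp // -[K *+ _]mulr_natl.
have := dimv_cap_compl V W; rewrite (capv_idPr WV) => <-.
by rewrite addKn natrX.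
Qed.

(** The factor [1 / 3] comes from the constant case. Each induction step multiplies by
    [delta ^+ 2 / 16] and divides by the new codimension, whence the factorial. *)
Definition rate (r : nat) : R :=
  (1 / 3 * (1 / 16) ^+ r * delta ^+ (2 * r) / (r`!)%:R)%R.

Lemma overlap_le r : forall V h,
  (forall i, (\dim V <= \dim (U i :&: V) + r)%N) ->
  overlap (unif_push (affine_set V h) output) (ber_prod (1 / 3))
    <= powR 2 (- (rate r * n%:R) + r%:R).
Proof.
have [d0 d1] := andP delta01.
elim: r => [|r IH] V h codim.
  rewrite addr0 /rate fact0 !expr0 !mulr1 divr1; apply: overlap_constant => i.
  have := codim i; rewrite addn0 => hi.
  have /dimv_leqif_sup : (U i :&: V <= V)%VS := capvSr _ _.
  move=> /geq_leqif; rewrite hi => /esym; rewrite subv_cap; by case/andP.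
have rate0 : 0 <= rate r by rewrite /rate !mulr_ge0 ?invr_ge0 ?exprn_ge0 ?divr_ge0.
have r1 : 0 < (r.+1)%:R :> R by rewrite ltr0n.
have rateS : rate r.+1 = rate r * (delta ^+ 2 / 16) / (r.+1)%:R.
  rewrite /rate factS natrM exprS mulnS exprD; field.
  by rewrite nat1r !pnatr_eq0 -!lt0n fact_gt0.
(* Threshold for the size of [S]: splitting into cosets costs at most [r.+1 * a] in the exponent,
   half of the gain [rate r * n] of the induction hypothesis. *)
pose a : R := (rate r * n%:R / (2 * (r.+1)%:R))%R.
have a0 : 0 <= a by apply: divr_ge0; apply: mulr_ge0; rewrite ?rate0 ?ler0n.
(* The target [(Num.truncn a).+1] exceeds [a], while a smaller [S] has at most [a] elements. *)
have [S [W [WV dimW WS indep alt]]] :=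
  mean_prod_independent n r.+1 (Num.truncn a).+1 V h U codim.
have /andP[ta at1] := truncn_itv a0.
case: (ltnP (Num.truncn a) #|S|) => [cS|cS].
  apply: le_trans (overlap_independent V h S indep) _.
  rewrite -[X in X * _](powRr1 (ler0n _ 2)) -powRD ?pnatr_eq0 ?implybT //.
  apply: ler_powR; first by rewrite ler1n.
  (* The leading factor 2 is absorbed by the summand [r.+1] of the exponent. *)
  rewrite addrC; apply: lerD; last by rewrite ler1n.
  rewrite lerN2 rateS.
  have -> : rate r * (delta ^+ 2 / 16) / (r.+1)%:R * n%:R = delta ^+ 2 / 8 * a.
    by rewrite /a; field; rewrite nat1r gt_eqF.
  apply: ler_wpM2l; first by rewrite divr_ge0 ?sqr_ge0.
  by apply: le_trans (ltW at1) _; rewrite ler_nat.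
have maxS i : i \notin S -> ~~ (V <= W + (U i :&: V))%VS.
  by case: alt => [e|]; [rewrite e ltnn in cS | apply].
(* For [i] in [S] the codimension is 0. Otherwise the codimension of [U i :&: W] in [W] is that of
   [U i :&: V] in [W + (U i :&: V)], a proper subspace of [V], so at least 1 is gained. *)
have codimW i : (\dim W <= \dim (U i :&: W) + r)%N.
  have [/WS WU|/maxS nV] := boolP (i \in S).
    by rewrite (capv_idPr WU) leq_addr.
  have sub : (W + (U i :&: V) <= V)%VS by rewrite subv_add WV capvSr.
  have lt : (\dim (W + (U i :&: V)) < \dim V)%N.
    by rewrite ltn_neqAle dimvS // andbT; move: (geq_leqif (dimv_leqif_sup sub));
       rewrite (negPf nV) leqNgt => /negbFE /ltn_eqF ->.
  have := dimv_sum_cap W (U i :&: V).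
  have -> : (W :&: (U i :&: V) = U i :&: W)%VS.
    by rewrite capvC -capvA (capv_idPr WV).
  move: lt (codim i).
  move: (\dim _) (\dim _) (\dim _) (\dim _) (\dim _) => b c d e f; lia.
apply: le_trans (overlap_split V W h _ WV (fun h' => IH W h' codimW)) _.
rewrite -powR_mulrn // -powRD ?pnatr_eq0 ?implybT //.
apply: ler_powR; first by rewrite ler1n.
have dimVW : (\dim V - \dim W)%:R <= (r.+1)%:R * a.
  apply: (@le_trans _ _ (r.+1 * #|S|)%:R).
    by rewrite ler_nat leq_subLR.
  by rewrite natrM ler_wpM2l // (le_trans _ ta) // ler_nat.
have half : (r.+1)%:R * a = rate r * n%:R / 2 by rewrite /a; field; rewrite nat1r gt_eqF.
(* The half of the exponent left after the union bound still covers the next rate, because [delta]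
   is at most 1. *)
have : rate r.+1 * n%:R <= rate r * n%:R / 2.
  have -> : rate r.+1 * n%:R = rate r * n%:R * (delta ^+ 2 / 16 / (r.+1)%:R).
    by rewrite rateS; field; rewrite nat1r gt_eqF.
  apply: ler_wpM2l; first exact: mulr_ge0.
  rewrite ler_pdivrMr //.
  have d2 : delta ^+ 2 <= 1 by rewrite expr_le1.
  have : 1 <= (r.+1)%:R :> R by rewrite ler1n.
  by lra.
rewrite half in dimVW; rewrite -[r.+1%:R]natr1.
by lra.
Qed.

End RankInduction.

(** * From overlap back to total variation, with an absolute constant *)

Theorem theorem8p1 :
  exists c : R, 0 < c /\
  forall (r n m : nat) (delta : R) (P : 'I_n -> 'rV['F_2]_m -> 'F_2),
    (1 <= r)%N -> 0 < delta ->
    (forall i, rank1_le (P i) r) ->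
    (forall i (V : {vspace 'rV['F_2]_m}) (h : 'rV['F_2]_m),
        delta <= tv (unif_push (affine_set V h) (P i)) (ber (1 / 3))) ->
    1 - powR 2 (- (c ^+ r * delta ^+ (2 * r) / (r`!)%:R * n%:R) + r%:R)
      <= tv (unif_push [set: 'rV['F_2]_m] (fun x => \row_i P i x))
            (ber_prod (1 / 3)).
Proof.
(* The constant is [1 / 3 * (1 / 16)]: as [r] is positive, [(1 / 3) ^+ r] is at most the single
   factor [1 / 3] in [rate]. *)
exists (1 / 48)%R; split=> [|r n m delta P r1 d0 rankP hdelta]; first lra.
have setT_affine : [set: 'rV['F_2]_m] = affine_set fullv 0.
  by apply/setP => x; rewrite !inE memvf.
have [U hU] := fin_all_exists (fun i => invariant_of_rank1_le _ _ _ (rankP i)).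
rewrite setT_affine tv_overlap ?sum_unif_push1 ?sum_ber_prod1 // lerD2l lerN2.
have delta1 : (0 < n)%N -> delta <= 1.
  move=> n0; pose i := Ordinal n0; set q := unif_push (affine_set fullv 0) (P i).
  have q01 : q 0 + q 1 = 1 by rewrite -sumF2 sum_unif_push1.
  apply: le_trans (hdelta i fullv 0) _; rewrite -/q tv_ber // ler_norml.
  have : 0 <= q 0 := unif_push_ge0 _ _ _ _ _.
  have : 0 <= q 1 := unif_push_ge0 _ _ _ _ _.
  by lra.
have codim i : (\dim (fullv : {vspace 'rV['F_2]_m}) <= \dim (U i :&: fullv) + r)%N.
  by rewrite capvf dimvf dim_matrix mul1r; case: (hU i).
(* With [n = 0] there is no upper bound on [delta], but its value is immaterial. *)
have [d [d01 hd rate_d]] : exists d : R, [/\ 0 <= d <= 1,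
    forall i V h, d <= tv (unif_push (affine_set V h) (P i)) (ber (1 / 3))
    & d ^+ (2 * r) * n%:R = delta ^+ (2 * r) * n%:R].
  case: (posnP n) => [n0|/delta1 d1]; last first.
    by exists delta; rewrite ltW.
  exists 0; split; rewrite ?lexx ?ler01 // ?n0 ?mulr0 //.
  by move=> i; have := ltn_ord i; rewrite {2}n0.
have := overlap_le P U d (fun i => (hU i).2) d01 hd r fullv 0 codim.
move/le_trans; apply; apply: ler_powR; first by rewrite ler1n.
rewrite lerD2r lerN2 /rate.
rewrite -mulrA [_^-1 * _]mulrC mulrA -[_ * _ * n%:R]mulrA -rate_d.
rewrite -[leRHS]mulrA [in leRHS](mulrC _^-1) [leRHS]mulrA -[_ * _ * n%:R in leRHS]mulrA.
apply: ler_wpM2r; first by rewrite invr_ge0.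
apply: ler_wpM2r; first by rewrite mulr_ge0 // exprn_ge0 //; case/andP: d01.
case: r r1 {rankP hU codim rate_d} => // r _.
have -> : 1 / 48 = 1 / 3 * (1 / 16) :> R by field.
rewrite exprMn; apply: ler_wpM2r; first by rewrite exprn_ge0 //; lra.
by rewrite exprS ger_pMr ?exprn_ile1 //; lra.
Qed.
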